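(* Let $G$ be the complete bipartite graph with vertex classes $V_1$, $|V_1|=m$, and $V_2$, $|V_2|=n$, $1\le m\le n$, let $\mathcal N$ be the set of its perfect matchings (matchings of size $m$), let $U:\mathcal N\to\mathbb R$ be any function, $\beta>0$, and let $\mathcal M$ be the Markov chain on $\mathcal N$ described below. Then the conductance of $\mathcal M$ satisfies $\Phi(\mathcal M)\ge \dfrac{1}{4\alpha^3 mn}$, where $\alpha=\exp\{\beta(U_{\max}-U_{\min})\}$.
   Context: The complete bipartite graph has edge set $V_1\times V_2$. A perfect matching is a set $M$ of edges, no two sharing an endpoint, such that every vertex of $V_1$ lies in exactly one edge of $M$. $U_{\max}=\max_{M\in\mathcal N}U(M)$, $U_{\min}=\min_{M\in\mathcal N}U(M)$. Two distinct $M,M'\in\mathcal N$ are adjacent if $M'$ is obtained from $M$ either by replacing an edge $(y,z_1)\in M$ with $(y,z)$ where $z\in V_2$ lies in no edge of $M$, or by replacing two edges $(y,z_1),(y_1,z)\in M$ with $(y,z),(y_1,z_1)$. The chain $\mathcal M$ has $P_{MM'}=\frac{1}{2mn}\min\{1,\exp(\beta(U(M')-U(M)))\}$ for adjacent $M,M'$, $P_{MM'}=0$ for distinct non-adjacent $M,M'$, and $P_{MM}=1-\sum_{M'\ne M}P_{MM'}$. Its stationary distribution is $\pi_M=e^{\beta U(M)}/\sum_{M'\in\mathcal N}e^{\beta U(M')}$. For $S\subseteq\mathcal N$, $\pi_S=\sum_{M\in S}\pi_M$, $S^c=\mathcal N\setminus S$, $Q(S,S^c)=\sum_{M\in S,M'\in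 S^c}\pi_MP_{MM'}$, and the conductance is $\Phi(\mathcal M)=\min_{S\subseteq\mathcal N,\,0<\pi_S\le 1/2}Q(S,S^c)/\pi_S$. *)

(* Defs.v *)
From mathcomp Require Import all_boot all_order all_algebra.
From mathcomp Require Import all_classical all_reals all_analysis.
Set Implicit Arguments.
Unset Strict Implicit.
Unset Printing Implicit Defensive.
Import Order.TTheory GRing.Theory Num.Theory.
Local Open Scope ring_scope.

Definition matching (V1 V2 : finType) (M : {set V1 * V2}) : bool :=
  [forall e in M, forall f in M,
     (e != f) ==> (e.1 != f.1) && (e.2 != f.2)].

Definition perfect_matching (V1 V2 : finType) (M : {set V1 * V2}) : bool :=
  matching M && [forall y : V1, #|[set e in M | e.1 == y]| == 1%N].

Definition pmatching (V1 V2 : finType) : finType :=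
  {M : {set V1 * V2} | perfect_matching M}.

Definition shift_move (V1 V2 : finType) (M M' : {set V1 * V2}) : bool :=
  [exists y : V1, exists z1 : V2, exists z : V2,
    [&& (y, z1) \in M,
        [forall e in M, e.2 != z]
      & M' == (y, z) |: (M :\ (y, z1))]].

Definition swap_move (V1 V2 : finType) (M M' : {set V1 * V2}) : bool :=
  [exists y : V1, exists z1 : V2, exists y1 : V1, exists z : V2,
    [&& (y, z1) \in M,
        (y1, z) \in M
      & M' == [set (y, z); (y1, z1)] :|:
              (M :\: [set (y, z1); (y1, z)])]].

Definition adjacent (V1 V2 : finType) (M M' : pmatching V1 V2) : bool :=
  (M != M') &&
  (shift_move (val M) (val M') || swap_move (val M) (val M')).

(* Meaningful for a nonempty [T] only: [fine] sends the value -oo (resp. +oo)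
   of the empty maximum (resp. minimum) to 0. *)
Definition fin_max (R : realType) (T : finType) (f : T -> R) : R :=
  fine (\big[Order.max/-oo%E]_(x : T) (f x)%:E).

Definition fin_min (R : realType) (T : finType) (f : T -> R) : R :=
  fine (\big[Order.min/+oo%E]_(x : T) (f x)%:E).

Definition move_prob (R : realType) (V1 V2 : finType)
    (U : pmatching V1 V2 -> R) (beta : R) (M M' : pmatching V1 V2) : R :=
  if adjacent M M' then
    (2 * #|V1|%:R * #|V2|%:R)^-1 * Num.min 1 (expR (beta * (U M' - U M)))
  else 0.

Definition trans_prob (R : realType) (V1 V2 : finType)
    (U : pmatching V1 V2 -> R) (beta : R) (M M' : pmatching V1 V2) : R :=
  if M == M' then 1 - \sum_(M'' | M'' != M) move_prob U beta M M''
  else move_prob U beta M M'.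

Definition stat_dist (R : realType) (V1 V2 : finType)
    (U : pmatching V1 V2 -> R) (beta : R) (M : pmatching V1 V2) : R :=
  expR (beta * U M) / \sum_(M' : pmatching V1 V2) expR (beta * U M').

Definition mass (R : realType) (T : finType) (p : T -> R) (S : {set T}) : R :=
  \sum_(x in S) p x.

Definition flow (R : realType) (T : finType) (p : T -> R) (P : T -> T -> R)
    (S : {set T}) : R :=
  \sum_(x in S) \sum_(y in ~: S) p x * P x y.

(* Valued in the extended reals so that the minimum over an empty family, which
   for a positive distribution occurs exactly when there is a single state,
   is +oo. *)
Definition conductance (R : realType) (T : finType) (p : T -> R)
    (P : T -> T -> R) : \bar R :=
  \big[Order.min/+oo%E]_(S : {set T} | 0 < mass p S <= 2^-1)
    (flow p P S / mass p S)%:E.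

(* Main.v *)
Require Import Defs.
From mathcomp Require Import all_boot all_order all_algebra all_fingroup.
From mathcomp Require Import all_classical all_reals all_analysis.
From mathcomp Require Import ring lra.
Set Implicit Arguments.
Unset Strict Implicit.
Unset Printing Implicit Defensive.
Import Order.TTheory GRing.Theory Num.Theory.
Local Open Scope ring_scope.

(** Stationary weights lie in an interval [[lo, alpha lo]], so everything reduces
    to the edge expansion [#|S| #|~: S| <= #|boundary S| #|N|] of the move graph,
    proved with canonical paths.  Enumerate [V1] as [v 0, v 1, ...].  The path
    from [M] to [M'] gives, at step [k], the vertex [v k] its partner in [M'] by
    composing the current matching with a transposition of [V2], as in a Knuth
    shuffle; so the matching after [k] steps is [s M] for a permutation [s] of
    [V2].  A step that changes the matching determines [k], and together with
    the complementary matching [s^-1 M'] it determines [M] and [M']: on the first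
    [k] vertices [s^-1 M'] agrees with [M] and [s M] agrees with [M'], and these
    values determine [s].  Hence each edge lies on at most [#|N|] paths. *)

(** * Perfect matchings as injections from [V1] to [V2], acted on by permutations of [V2] *)

Section Mate.
Variables V1 V2 : finType.
Implicit Types (M : pmatching V1 V2) (f : V1 -> V2) (s : {perm V2}).

Lemma mate_exists M y : exists z, (y, z) \in val M.
Proof.
case: M => M /= /andP[_ /forallP/(_ y)/cards1P[[x z] E]].
have : (x, z) \in [set e in M | e.1 == y] by rewrite E inE.
by rewrite inE /= => /andP[Mxz /eqP <-]; exists z.
Qed.

Definition mate M y : V2 := xchoose (mate_exists M y).

Lemma mate_in M y : (y, mate M y) \in val M.
Proof. exact: (xchooseP (mate_exists M y)). Qed.

Lemma pmatchingP M e e' : e \in val M -> e' \in val M ->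
  e != e' -> (e.1 != e'.1) && (e.2 != e'.2).
Proof.
case: M => M /= /andP[/forall_inP H _] eM e'M.
by move/forall_inP/(_ e' e'M)/implyP: (H e eM).
Qed.

Lemma mem_pmatching M e : (e \in val M) = (e.2 == mate M e.1).
Proof.
case: e => y z /=; apply/idP/eqP => [Myz|->]; last exact: mate_in.
apply/eqP; apply: contraTT isT => nz.
have := pmatchingP Myz (mate_in M y).
by rewrite xpair_eqE eqxx /= => /(_ nz).
Qed.

Lemma mate_inj M : injective (mate M).
Proof.
move=> x y E; apply/eqP; apply: contraTT isT => nxy.
have := pmatchingP (mate_in M x) (mate_in M y).
by rewrite xpair_eqE E eqxx andbT /= andbF => /(_ nxy).
Qed.

Lemma eq_mate M M' : mate M =1 mate M' -> M = M'.
Proof.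
by move=> E; apply/val_inj/setP => e; rewrite !mem_pmatching E.
Qed.

Lemma perfect_graph f : injective f ->
  perfect_matching [set e : V1 * V2 | e.2 == f e.1].
Proof.
move=> f_inj; apply/andP; split; last first.
  apply/forallP => y; apply/cards1P; exists (y, f y).
  apply/setP => -[x z]; rewrite !inE /= xpair_eqE andbC.
  by case: eqP => [->|].
apply/forall_inP => -[x z]; rewrite inE /= => /eqP->.
apply/forall_inP => -[y w]; rewrite inE /= => /eqP->.
by rewrite xpair_eqE (inj_eq f_inj) !andbb implybb.
Qed.

Definition graph_pmatching f (f_inj : injective f) : pmatching V1 V2 :=
  exist _ [set e : V1 * V2 | e.2 == f e.1] (perfect_graph f_inj).

Definition permute s M : pmatching V1 V2 :=
  graph_pmatching (inj_comp (@perm_inj _ s) (@mate_inj M)).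

Lemma mate_permute s M y : mate (permute s M) y = s (mate M y).
Proof. by have := mate_in (permute s M) y; rewrite inE => /eqP. Qed.

(** The status of [z] in [M] decides the kind of move: a swap when [z] is the partner of some [y1],
    a shift when [z] is free. *)
Lemma adjacent_tperm M M' y z : M != M' ->
  mate M' =1 tperm (mate M y) z \o mate M -> Defs.adjacent M M'.
Proof.
move=> neqM E; rewrite /Defs.adjacent neqM /=.
have Ey : mate M' y = z by rewrite E /= tpermL.
have [[y1 Ez]|free] := pselect (exists y1, z = mate M y1).
  apply/orP; right; apply/existsP; exists y; apply/existsP; exists (mate M y).
  apply/existsP; exists y1; apply/existsP; exists z.
  rewrite mate_in Ez mate_in /=; apply/eqP/setP => -[x w].
  rewrite !inE !mem_pmatching /= !xpair_eqE E /= Ez.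
  have [->|nxy] := eqVneq x y.
    rewrite tpermL; have [<-|nyy1] := eqVneq y y1; last first.
      by case: (w == mate M y); case: (w == mate M y1).
    by case: (w == mate M y).
  have [->|nxy1] := eqVneq x y1; first
    by rewrite tpermR /=; case: (w == mate M y); case: (w == mate M y1).
  by rewrite tpermD // (inj_eq (@mate_inj M)) eq_sym.
apply/orP; left; apply/existsP; exists y; apply/existsP; exists (mate M y).
apply/existsP; exists z; rewrite mate_in /=; apply/andP; split.
  apply/forall_inP => e; rewrite mem_pmatching => /eqP->.
  by apply/eqP => zE; apply: free; exists e.1.
apply/eqP/setP => -[x w]; rewrite !inE !mem_pmatching /= !xpair_eqE E /=.
have [->|nxy] := eqVneq x y.
  by rewrite tpermL /= andNb orbF.
rewrite /= tpermD //; first by rewrite (inj_eq (@mate_inj M)) eq_sym.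
by apply/eqP => zE; apply: free; exists x.
Qed.

End Mate.

(** * Canonical paths, their encoding, and the edge expansion of the move graph *)

Section Route.
Variables (V1 V2 : finType) (m : nat) (v : nat -> V1).
Hypothesis v_inj : {in gtn m &, injective v}.

(** Products of permutations apply the left factor first, so the new transposition acts on the
    current partner of [v j]. *)
Fixpoint route (a b : V1 -> V2) (k : nat) : {perm V2} :=
  if k is j.+1 then
    let s := route a b j in (s * tperm (s (a (v j))) (b (v j)))%g
  else 1%g.

Lemma routeS a b k : route a b k.+1 =
  (route a b k * tperm (route a b k (a (v k))) (b (v k)))%g.
Proof. by []. Qed.

(** Settled vertices stay settled: step [k] moves only the current image of [a (v k)] and the value
    [b (v k)], and by injectivity neither equals [b (v j)] for [j < k]. *)
Lemma route_target a b : injective a -> injective b ->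
  forall k j, (k <= m)%N -> (j < k)%N -> route a b k (a (v j)) = b (v j).
Proof.
move=> a_inj b_inj; elim=> [//|k IH] j km; rewrite ltnS leq_eqVlt routeS permM.
have [->|njk /= jk] := eqVneq j k; first by rewrite tpermL.
have nv : v k != v j.
  apply: contraNneq njk => /v_inj -> //; rewrite inE //.
  exact: ltn_trans jk km.
rewrite tpermD ?(IH _ (ltnW km) jk) //; last by rewrite (inj_eq b_inj).
by rewrite -(IH _ (ltnW km) jk) (inj_eq perm_inj) (inj_eq a_inj).
Qed.

(** Serves the decoding: the values readable from [costage] and [stage] suffice to recover the
    permutation. *)
Lemma eq_route (a b a' b' : V1 -> V2) k :
  (forall j, (j < k)%N -> a (v j) = a' (v j)) ->
  (forall j, (j < k)%N -> b (v j) = b' (v j)) ->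
  route a b k = route a' b' k.
Proof.
elim: k => [//|k IH] Ea Eb; rewrite !routeS Ea // Eb // IH // => j jk.
  exact/Ea/ltnW.
exact/Eb/ltnW.
Qed.

Hypothesis v_surj : forall y, exists2 k, (k < m)%N & v k = y.

Definition stage (M M' : pmatching V1 V2) k :=
  permute (route (mate M) (mate M') k) M.

(* The matching that encodes the endpoints of a path given its [k]-th step. *)
Definition costage (M M' : pmatching V1 V2) k :=
  permute (route (mate M) (mate M') k)^-1%g M'.

Lemma mate_stage M M' k j : (k <= m)%N -> (j < k)%N ->
  mate (stage M M' k) (v j) = mate M' (v j).
Proof.
move=> km jk; rewrite mate_permute.
exact: (route_target (@mate_inj _ _ M) (@mate_inj _ _ M') km jk).
Qed.

Lemma mate_costage M M' k j : (k <= m)%N -> (j < k)%N ->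
  mate (costage M M' k) (v j) = mate M (v j).
Proof.
move=> km jk; rewrite mate_permute.
rewrite -(route_target (@mate_inj _ _ M) (@mate_inj _ _ M') km jk).
by rewrite permK.
Qed.

Lemma stage0 M M' : stage M M' 0 = M.
Proof. by apply: eq_mate => y; rewrite mate_permute perm1. Qed.

Lemma stage_end M M' : stage M M' m = M'.
Proof. by apply: eq_mate => y; have [k km <-] := v_surj y; exact: mate_stage. Qed.

Lemma mate_stageS M M' k : mate (stage M M' k.+1) =1
  tperm (mate (stage M M' k) (v k)) (mate M' (v k)) \o mate (stage M M' k).
Proof. by move=> y; rewrite /= !mate_permute routeS permM. Qed.

Lemma adjacent_stage M M' k :
  stage M M' k != stage M M' k.+1 ->
  Defs.adjacent (stage M M' k) (stage M M' k.+1).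
Proof. by move=> nK; exact: (adjacent_tperm nK (mate_stageS _ _ _)). Qed.

(** If [v k] kept its partner, the transposition would be trivial and so would the step. *)
Lemma stage_neq M M' k : (k < m)%N -> stage M M' k != stage M M' k.+1 ->
  mate (stage M M' k) (v k) != mate (stage M M' k.+1) (v k).
Proof.
move=> km; apply: contraNneq => E; apply/eqP/eq_mate => y.
by rewrite mate_stageS /= E mate_stage // tperm1 perm1.
Qed.

Lemma stage_step_inj M1 M1' M2 M2' k1 k2 : (k1 < m)%N -> (k2 < m)%N ->
  stage M1 M1' k1 != stage M1 M1' k1.+1 ->
  stage M1 M1' k1 = stage M2 M2' k2 ->
  stage M1 M1' k1.+1 = stage M2 M2' k2.+1 ->
  costage M1 M1' k1 = costage M2 M2' k2 ->
  M1 = M2 /\ M1' = M2'.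
Proof.
move=> k1m k2m nK EK EK' EL.
have Ek : k1 = k2.
  (* [k] is the first index at which the two ends of the step differ. *)
  wlog lt_k : M1 M1' M2 M2' k1 k2 k1m k2m nK EK EK' EL / (k1 < k2)%N.
    move=> W; case: (ltngtP k1 k2) => // [|] lt_k; first exact: (W M1 M1' M2 M2').
    by symmetry; apply: (W M2 M2' M1 M1') => //; rewrite -EK -EK'.
  (* As [k1 < k2], both ends of the second step already agree with [M2'] at [v k1], whereas the
     first step changes the partner of [v k1]. *)
  have := stage_neq k1m nK.
  by rewrite EK EK' !mate_stage ?eqxx // ltnW.
subst k2; have km := ltnW k1m.
have Er : route (mate M1) (mate M1') k1 = route (mate M2) (mate M2') k1.
  apply: eq_route => j jk.
    by rewrite -(@mate_costage M1 M1' k1) // EL mate_costage.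
  by rewrite -(@mate_stage M1 M1' k1) // EK mate_stage.
split; apply: eq_mate => y.
  have /(congr1 (fun M => mate M y)) := EK.
  by rewrite !mate_permute Er => /perm_inj.
have /(congr1 (fun M => mate M y)) := EL.
by rewrite !mate_permute Er => /perm_inj.
Qed.

Lemma exit_step (p : pred nat) k : p 0%N -> ~~ p k ->
  exists2 j, (j < k)%N & p j && ~~ p j.+1.
Proof.
move=> p0; elim: k => [/negP//|k IH] npk.
have [pk|/IH[j jk pj]] := boolP (p k); first by exists k; rewrite // pk.
by exists j => //; exact: ltnW.
Qed.

Lemma exit_stage (S : {set pmatching V1 V2}) M M' : M \in S -> M' \notin S ->
  exists k : 'I_m, (stage M M' k \in S) && (stage M M' k.+1 \notin S).
Proof.
move=> MS M'S.
have [||k km H] := @exit_step (fun k => stage M M' k \in S) m.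
- by rewrite stage0.
- by rewrite stage_end.
by exists (Ordinal km).
Qed.

Definition boundary (S : {set pmatching V1 V2}) :=
  [set e : pmatching V1 V2 * pmatching V1 V2
   | [&& e.1 \in S, e.2 \notin S & Defs.adjacent e.1 e.2]].

(** A path from [S] to its complement leaves [S] at some step; sending its endpoints to that
    boundary edge and the [costage] there is injective. *)
Lemma route_expansion (S : {set pmatching V1 V2}) :
  (#|S| * #|~: S| <= #|boundary S| * #|{: pmatching V1 V2}|)%N.
Proof.
have exit_at (e : pmatching V1 V2 * pmatching V1 V2) :
    {k : nat | e \in finset.setX S (~: S) -> [/\ (k < m)%N,
      stage e.1 e.2 k \in S & stage e.1 e.2 k.+1 \notin S]}.
  (* Pairs that do not cross from [S] to its complement get the dummy index 0. *)
  have [|] := boolP (e \in finset.setX S (~: S)); last by exists 0%N.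
  case: e => M M' /finset.setXP[eS eS'].
  rewrite inE in eS'; have /sigW[k /andP[kS kS']] := exit_stage eS eS'.
  by exists k.
pose t e := sval (exit_at e).
pose code (e : pmatching V1 V2 * pmatching V1 V2) :=
  ((stage e.1 e.2 (t e), stage e.1 e.2 (t e).+1), costage e.1 e.2 (t e)).
rewrite -!cardsX -cardsT -cardsX.
have <- : #|code @: finset.setX S (~: S)| = #|finset.setX S (~: S)|.
  apply: card_in_imset => -[M1 M1'] [M2 M2'] h1 h2 E.
  have [k1m k1S k1S'] := svalP (exit_at (M1, M1')) h1.
  have [k2m _ _] := svalP (exit_at (M2, M2')) h2.
  have EK := congr1 (fun c => c.1.1) E.
  have EK' := congr1 (fun c => c.1.2) E.
  have EL := congr1 snd E.
  have nK : stage M1 M1' (t (M1, M1')) != stage M1 M1' (t (M1, M1')).+1.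
    by apply: contraTneq k1S => ->.
  by have [-> ->] := stage_step_inj k1m k2m nK EK EK' EL.
apply/subset_leq_card/fintype.subsetP => _ /imsetP[e he ->].
have [_ kS kS'] := svalP (exit_at e) he.
rewrite !inE /= andbT kS kS' /= adjacent_stage //.
by apply: contraTneq kS => ->.
Qed.

End Route.

Lemma boundary_expansion (V1 V2 : finType) (S : {set pmatching V1 V2}) :
  (0 < #|V1|)%N ->
  (#|S| * #|~: S| <= #|boundary S| * #|{: pmatching V1 V2}|)%N.
Proof.
move=> /card_gt0P[y0 _].
apply: (@route_expansion V1 V2 #|V1| (nth y0 (enum V1))) => [i j im jm E|y].
  by apply/eqP; rewrite -(nth_uniq y0 _ _ (enum_uniq V1)) -?cardE // E.
exists (index y (enum V1)); last by rewrite nth_index // mem_enum.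
by rewrite cardE index_mem mem_enum.
Qed.

Lemma le_fin_max (R : realType) (T : finType) (f : T -> R) x :
  f x <= fin_max f.
Proof.
rewrite -lee_fin /fin_max fineK; first exact: (le_bigmax _ (EFin \o f)).
(* Since [x] inhabits [T], the maximum is attained, hence finite. *)
have [|i _ ->] := @eq_bigmax _ _ _ -oo%E x predT (EFin \o f) isT; last by [].
by move=> i _; exact: leNye.
Qed.

Lemma fin_min_le (R : realType) (T : finType) (f : T -> R) x :
  fin_min f <= f x.
Proof.
rewrite -lee_fin /fin_min fineK; first exact: (bigmin_le _ _ (EFin \o f)).
have [|i _ ->] := @eq_bigmin _ _ _ +oo%E x predT (EFin \o f) isT; last by [].
by move=> i _; exact: leey.
Qed.

(** * Bounds on stationary weights, flow and mass in terms of the boundary *)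

Section Gibbs.
Variables (R : realType) (V1 V2 : finType).
Variables (U : pmatching V1 V2 -> R) (beta : R).
Hypothesis beta_gt0 : 0 < beta.
Implicit Types (M : pmatching V1 V2) (S : {set pmatching V1 V2}).

Let Z := \sum_(M : pmatching V1 V2) expR (beta * U M).
Let lo := expR (beta * fin_min U) / Z.
Let alpha := expR (beta * (fin_max U - fin_min U)).

Lemma partition_ge0 : 0 <= Z.
Proof. by apply: sumr_ge0 => M _; exact: expR_ge0. Qed.

Lemma stat_dist_ge M : lo <= stat_dist U beta M.
Proof.
by rewrite ler_wpM2r ?invr_ge0 ?partition_ge0 // ler_expR ler_pM2l ?fin_min_le.
Qed.

Lemma stat_dist_le M : stat_dist U beta M <= alpha * lo.
Proof.
rewrite mulrA -expRD -mulrDr subrK.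
by rewrite ler_wpM2r ?invr_ge0 ?partition_ge0 // ler_expR ler_pM2l ?le_fin_max.
Qed.

(** The state [M] witnesses that the partition function is positive. *)
Lemma stat_dist_sum M : \sum_M' stat_dist U beta M' = 1.
Proof.
rewrite -mulr_suml divff // gt_eqF // (bigD1 M) //=.
by rewrite ltr_pwDl ?expR_gt0 // sumr_ge0 // => M' _; exact: expR_ge0.
Qed.

Lemma mass_le S : mass (stat_dist U beta) S <= #|S|%:R * (alpha * lo).
Proof.
rewrite mulr_natl -sumr_const; apply: ler_sum => M _; exact: stat_dist_le.
Qed.

(* Detailed balance: the flow along an edge is the smaller of the two
   stationary weights, up to the factor 1 / (2mn). *)
Lemma flow_edge_ge M M' : Defs.adjacent M M' ->
  (2 * #|V1|%:R * #|V2|%:R)^-1 * lo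
  <= stat_dist U beta M * trans_prob U beta M M'.
Proof.
move=> adj; have /negPf neqM : M != M' by case/andP: adj.
rewrite /trans_prob neqM /move_prob adj [leRHS]mulrCA.
rewrite ler_wpM2l ?invr_ge0 ?mulr_ge0 //.
rewrite minr_pMr ?divr_ge0 ?expR_ge0 ?partition_ge0 // le_min mulr1.
rewrite stat_dist_ge /= /stat_dist mulrAC -expRD -mulrDr addrC subrK.
exact: stat_dist_ge.
Qed.

Lemma trans_prob_ge0 M M' : M != M' -> 0 <= trans_prob U beta M M'.
Proof.
move=> /negPf neqM; rewrite /trans_prob neqM /move_prob.
by case: ifP.
Qed.

Lemma flow_ge S :
  #|boundary S|%:R * ((2 * #|V1|%:R * #|V2|%:R)^-1 * lo)
  <= flow (stat_dist U beta) (trans_prob U beta) S.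
Proof.
rewrite /flow pair_big /= mulr_natl -sumr_const.
rewrite (eq_bigl (fun e => ((e.1 \in S) && (e.2 \in ~: S))
                           && Defs.adjacent e.1 e.2)); last first.
  by move=> e; rewrite !inE -andbA.
rewrite big_mkcondr /=; apply: ler_sum => -[M M'] /= /andP[MS M'S].
case: ifPn => [/flow_edge_ge//|_].
rewrite mulr_ge0 ?divr_ge0 ?expR_ge0 ?partition_ge0 // trans_prob_ge0 //.
by apply: contraTneq MS => ->; rewrite inE in M'S.
Qed.

(** With [N] the number of states, the mass of [S] is at most twice the product of the masses of [S]
    and [~: S], hence at most [2 * #|S| * #|~: S| * (alpha * lo)^2]. Edge expansion replaces
    [#|S| * #|~: S|] by [#|boundary S| * N], and [N * lo <= 1] absorbs [N]. *)
Lemma mass_le_boundary S : (0 < #|V1|)%N ->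
  0 < mass (stat_dist U beta) S <= 2^-1 ->
  mass (stat_dist U beta) S <= 2 * #|boundary S|%:R * alpha ^+ 2 * lo.
Proof.
move=> V1_gt0 /andP[S_gt0 S_le]; set p := stat_dist U beta in S_gt0 S_le *.
have [M MS] : exists M, M \in S.
  apply/set0Pn; apply: contraTneq S_gt0 => ->.
  by rewrite /mass big_set0 ltxx.
have sum1 := stat_dist_sum M.
have lo_ge0 : 0 <= lo by rewrite divr_ge0 ?expR_ge0 ?partition_ge0.
have alpha_ge0 : 0 <= alpha := expR_ge0 _.
have massC : mass p S + mass p (~: S) = 1.
  rewrite -sum1 /mass [RHS](bigID (mem S)) /=; congr (_ + _).
  by apply: eq_bigl => M'; rewrite inE.
have N_lo : #|{: pmatching V1 V2}|%:R * lo <= 1.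
  rewrite -[leRHS]sum1 mulr_natl -sumr_const; apply: ler_sum => M' _.
  exact: stat_dist_ge.
have expand : #|S|%:R * #|~: S|%:R
    <= #|boundary S|%:R * #|{: pmatching V1 V2}|%:R :> R.
  by rewrite -!natrM ler_nat boundary_expansion.
(* The complement has mass at least 1/2. *)
have step1 : mass p S <= 2 * (mass p S * mass p (~: S)).
  rewrite mulrCA ler_peMr ?(ltW S_gt0) //; lra.
apply: (le_trans step1).
rewrite -2!(mulrA 2) ler_pM2l //.
apply: (@le_trans _ _ ((#|S|%:R * (alpha * lo)) * (#|~: S|%:R * (alpha * lo)))).
  apply: ler_pM; [exact: ltW| |exact: mass_le..].
  by apply: sumr_ge0 => M' _; rewrite divr_ge0 ?expR_ge0 ?partition_ge0.
rewrite mulrACA.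
have hi2_ge0 : 0 <= alpha * lo * (alpha * lo) by rewrite -expr2 sqr_ge0.
apply: (le_trans (ler_wpM2r hi2_ge0 expand)).
have -> : #|boundary S|%:R * #|{: pmatching V1 V2}|%:R
    * (alpha * lo * (alpha * lo))
  = #|boundary S|%:R * alpha ^+ 2 * lo * (#|{: pmatching V1 V2}|%:R * lo).
  by ring.
by rewrite ler_piMr // mulr_ge0 // mulr_ge0 // sqr_ge0.
Qed.

End Gibbs.

Theorem theorem3 (R : realType) (V1 V2 : finType) (m n : nat)
    (hV1 : #|V1| = m) (hV2 : #|V2| = n) (hm : (1 <= m)%N) (hmn : (m <= n)%N)
    (U : pmatching V1 V2 -> R) (beta : R) (hbeta : 0 < beta) :
  let alpha := expR (beta * (fin_max U - fin_min U)) in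
  ((1 / (4 * alpha ^+ 3 * m%:R * n%:R))%:E
     <= conductance (stat_dist U beta) (trans_prob U beta))%E.
Proof.
(* The default [+oo] of the minimum satisfies the bound trivially. *)
cbv zeta; set alpha := expR _; apply: le_bigmin => [|S S_small]; first exact: leey.
have /andP[S_gt0 _] := S_small; rewrite lee_fin ler_pdivlMr //.
have [M _] : exists M, M \in S.
  apply/set0Pn; apply: contraTneq S_gt0 => ->.
  by rewrite /mass big_set0 ltxx.
have m_gt0 : 0 < m%:R :> R by rewrite ltr0n.
have n_gt0 : 0 < n%:R :> R by rewrite ltr0n (leq_trans hm).
have alpha_ge1 : 1 <= alpha.
  rewrite -expR0 ler_expR mulr_ge0 ?(ltW hbeta) // subr_ge0.
  exact: le_trans (fin_min_le _ M) (le_fin_max _ M).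
have alpha_gt0 : 0 < alpha := lt_le_trans ltr01 alpha_ge1.
apply: le_trans (flow_ge U hbeta S); rewrite hV1 hV2.
set lo := expR _ / _.
have lo_ge0 : 0 <= lo by rewrite divr_ge0 ?expR_ge0 ?partition_ge0.
have V1_gt0 : (0 < #|V1|)%N by rewrite hV1.
have := mass_le_boundary hbeta V1_gt0 S_small; rewrite -/alpha -/lo => mass_S.
(* The constant 4 combines the 2 of the proposal probability with the 2 of the mass bound. The
   exponent 3 exceeds the 2 of that bound, which [alpha >= 1] permits. *)
have -> : #|boundary S|%:R * ((2 * m%:R * n%:R)^-1 * lo) =
    1 / (4 * alpha ^+ 3 * m%:R * n%:R)
      * (2 * #|boundary S|%:R * alpha ^+ 3 * lo).
  by field; rewrite !gt_eqF.
apply: ler_wpM2l; first by rewrite divr_ge0 ?mulr_ge0 ?exprn_ge0 ?(ltW alpha_gt0).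
apply: (le_trans mass_S); rewrite ler_wpM2r // ler_wpM2l ?mulr_ge0 //.
by rewrite ler_weXn2l.
Qed.
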